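(* Let $(X,f)$ be a dynamical system. Then the following statements are equivalent: (1) $f$ has the average shadowing property; (2) $f$ has the $\mathscr{M}_{\alpha}$-shadowing property for every $\alpha\in[0,1)$; (3) $f$ has the weak asymptotic average shadowing property; (4) for any $\alpha\in[0,1)$, any $\varepsilon>0$ and any asymptotic average pseudo-orbit $\{x_i\}_{i=0}^\infty$ of $f$, there exists $z\in X$ such that $\{x_i\}_{i=0}^\infty$ is $\mathscr{M}_{\alpha}$-$\varepsilon$-shadowed by $z$; (5) for any $\alpha\in[0,1)$ and any $\varepsilon>0$, there exists $\delta>0$ such that every $\delta$-average-pseudo-orbit of $f$ is $\mathscr{M}_{\alpha}$-$\varepsilon$-shadowed by some point in $X$; (6) for any $\varepsilon>0$, there exists $\delta>0$ such that every $\delta$-asymptotic-average-pseudo-orbit of $f$ is $\varepsilon$-shadowed on average by some point in $X$.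
   Context: $\mathbb{N}_0=\{0,1,2,\dots\}$. A dynamical system $(X,f)$ is a compact metric space $(X,d)$ together with a continuous map $f\colon X\to X$ (not assumed surjective). For $A\subset\mathbb{N}_0$, $\underline{d}(A)=\liminf_{n\to\infty}\frac1n|A\cap\{0,\dots,n-1\}|$. A sequence $\{x_i\}_{i=0}^\infty\subset X$ is: a $\delta$-ergodic pseudo-orbit of $f$ if $\lim_{n\to\infty}\frac1n|\{0\le i<n: d(f(x_i),x_{i+1})\ge\delta\}|=0$; a $\delta$-average-pseudo-orbit if there is $N>0$ such that $\frac1n\sum_{i=0}^{n-1}d(f(x_{i+k}),x_{i+k+1})<\delta$ for all $n\ge N$ and all integers $k\ge0$; a $\delta$-asymptotic-average-pseudo-orbit if $\limsup_{n\to\infty}\frac1n\sum_{i=0}^{n-1}d(f(x_i),x_{i+1})<\delta$; an asymptotic average pseudo-orbit if $\lim_{n\to\infty}\frac1n\sum_{i=0}^{n-1}d(f(x_i),x_{i+1})=0$. A sequence $\{x_i\}_{i=0}^\infty$ is $\varepsilon$-shadowed on average by $z\in X$ if $\limsup_{n\to\infty}\frac1n\sum_{i=0}^{n-1}d(f^i(z),x_i)<\varepsilon$, and is $\mathscr{M}_{\alpha}$-$\varepsilon$-shadowed by $z$ if $\underline{d}(\{i\in\mathbb{N}_0: d(f^i(z),x_i)<\varepsilon\})>\alpha$. $f$ has: the average shadowing property if for every $\varepsilon>0$ there is $\delta>0$ such that every $\delta$-average-pseudo-orbit is $\varepsilon$-shadowed on average by some point of $X$; the weak asymptotic average shadowing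 property if for every $\varepsilon>0$ every asymptotic average pseudo-orbit is $\varepsilon$-shadowed on average by some point of $X$; the $\mathscr{M}_{\alpha}$-shadowing property if for every $\varepsilon>0$ there is $\delta>0$ such that every $\delta$-ergodic pseudo-orbit is $\mathscr{M}_{\alpha}$-$\varepsilon$-shadowed by some point of $X$. *)

(* Defs.v *)
From mathcomp Require Export all_boot all_order all_algebra.
From mathcomp Require Export all_classical all_reals all_analysis.
Export Order.TTheory GRing.Theory Num.Theory.
Export numFieldNormedType.Exports.

Set Implicit Arguments.
Unset Strict Implicit.
Unset Printing Implicit Defensive.

Local Open Scope classical_set_scope.
Local Open Scope ring_scope.

(* At n = 0 both [average] and [frequency] are 0, since 0^-1 = 0; only their
   behaviour as n tends to infinity is ever used. *)
Definition average (R : realType) (u : nat -> R) (n : nat) : R :=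
  n%:R^-1 * \sum_(i < n) u i.

Definition frequency (R : realType) (A : set nat) (n : nat) : R :=
  n%:R^-1 * #|[pred i : 'I_n | (i : nat) \in A]|%:R.

(* Limits inferior and superior are taken in the extended reals, so that they
   are meaningful without any boundedness side condition. *)
Definition lower_density (R : realType) (A : set nat) : \bar R :=
  limn_einf (fun n => (frequency R A n)%:E).

Definition limsup_average (R : realType) (u : nat -> R) : \bar R :=
  limn_esup (fun n => (average u n)%:E).

Section Shadowing.
Context {R : realType} {X : metricType R}.
Implicit Types (f : X -> X) (x : nat -> X) (z : X) (alpha delta eps : R).

Definition step_error f x (i : nat) : R := mdist (f (x i)) (x i.+1).

Definition tracing_error f x z (i : nat) : R := mdist (iter i f z) (x i).

Definition ergodic_pseudo_orbit f delta x : Prop :=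
  frequency R [set i | delta <= step_error f x i] @ \oo --> (0 : R).

Definition average_pseudo_orbit f delta x : Prop :=
  exists N : nat, (0 < N)%N /\
    forall n k : nat, (N <= n)%N ->
      average (fun i => step_error f x (i + k)) n < delta.

Definition delta_asymptotic_average_pseudo_orbit f delta x : Prop :=
  (limsup_average (step_error f x) < delta%:E)%E.

Definition asymptotic_average_pseudo_orbit f x : Prop :=
  average (step_error f x) @ \oo --> (0 : R).

Definition shadowed_on_average f eps x z : Prop :=
  (limsup_average (tracing_error f x z) < eps%:E)%E.

Definition M_shadowed f alpha eps x z : Prop :=
  (alpha%:E < lower_density R [set i | (tracing_error f x z i < eps)%R])%E.

Definition average_shadowing_property f : Prop :=
  forall eps, 0 < eps -> exists delta, 0 < delta /\
    forall x, average_pseudo_orbit f delta x ->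
      exists z, shadowed_on_average f eps x z.

Definition weak_asymptotic_average_shadowing_property f : Prop :=
  forall eps, 0 < eps ->
    forall x, asymptotic_average_pseudo_orbit f x ->
      exists z, shadowed_on_average f eps x z.

Definition M_shadowing_property f alpha : Prop :=
  forall eps, 0 < eps -> exists delta, 0 < delta /\
    forall x, ergodic_pseudo_orbit f delta x ->
      exists z, M_shadowed f alpha eps x z.

End Shadowing.

(* Main.v *)
Require Import Defs.
From mathcomp Require Import ring lra zify.

(** Three mechanisms make the six properties equivalent.

    The two notions of shadowing agree once they are required at every
    precision. By Markov's inequality a small average tracing error forces the
    error to be small outside a set of small upper density
    ([M_shadowed_of_average]); conversely, since a compact space has finite
    diameter D, an error below eps outside a set of upper density a has mean at
    most D a + eps ([average_of_M_shadowed]). The same two estimates compare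
    ergodic pseudo-orbits with pseudo-orbits of small mean error. This settles
    every implication except the passage from a property that concerns few
    pseudo-orbits to the last and apparently strongest one, which concerns all
    pseudo-orbits whose mean error has limsup below delta.

    From average shadowing ([average_shadowing_asymptotic_error]): a small
    limsup says nothing about averages over windows that start late. Cut time
    into blocks of a large length N and replace x, on each block where its
    total error is too large, by the true orbit of the first point of the
    block. On a replaced block the new sequence y errs only at the end, by at
    most D, which is negligible against N; hence all long windows of y have a
    small mean error and y is an average pseudo-orbit. A
    replaced block costs at most D N in distance between x and y, but it was
    replaced because the error of x on it was comparable to N. So the mean
    distance between x and y is controlled by the mean error of x, and a point
    that shadows y also shadows x.

    From weak asymptotic average shadowing
    ([weak_asymptotic_shadowing_asymptotic_error]): suppose that for each n
    some s_n of mean error below 1/(n+1) is not eps-shadowed by any point. By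
    compactness, for every L0 there is L1 such that the orbit of every point of
    X is, at some time between L0 and L1, on average eps/2 away from s_n
    ([uniform_unshadowed_window]). Concatenate initial segments of s_0, s_1,
    and so on, starting the n-th one at a time t_n and making it so long that
    it contains this window for L0 = t_n, and that it dwarfs the errors made so
    far and the initial errors of the next segment. The result y is an
    asymptotic average pseudo-orbit ([concatenate]). Whatever z is, the orbit
    of f^(t_n)(z) is on average eps/2 away from s_n up to some time within the
    n-th segment, and this takes at least as long as the whole past; so the mean tracing error of y by z exceeds
    eps/4 infinitely often, a contradiction. *)

Set Implicit Arguments.
Unset Strict Implicit.
Unset Printing Implicit Defensive.

Local Open Scope classical_set_scope.
Local Open Scope ring_scope.

(** * Upper averages of real sequences *)

Section AverageSums.
Context {R : realType}.
Implicit Types (u v : nat -> R) (a b c K C : R).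

(** All later estimates are about partial sums; this removes the extended reals
    and the division by n. The intermediate constant c is what remains of the
    strict inequality after passing to the limit. *)
Lemma limsup_average_lt u a :
  (limsup_average u < a%:E)%E <->
  exists2 c, c < a & \forall n \near \oo, \sum_(i < n) u i <= c * n%:R.
Proof.
split=> [/ereal_inf_lt[s [V [N _ NV] <-] sa]|[c ca Hc]].
  have uV n : V n -> ((average u n)%:E <= ereal_sup [set (average u k)%:E | k in V])%E.
    by move=> Vn; apply: ereal_sup_ubound; exists n.
  (* the supremum over a tail is finite: it is below a and above some average *)
  move: sa uV; case: (ereal_sup _) => [c| |]; last 2 first.
  - by [].
  - by move=> _ /(_ N (NV N (leqnn N))).
  rewrite lte_fin => ca uV; exists c => //.
  near=> n; have n0 : 0 < n%:R :> R by rewrite ltr0n; near: n; exact: nbhs_infty_gt.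
  have : ((average u n)%:E <= c%:E)%E by apply: uV; apply: NV; near: n; exists N.
  by rewrite lee_fin /average mulrC ler_pdivrMr.
apply: (@le_lt_trans _ _ c%:E); last by rewrite lte_fin.
apply: ge_ereal_inf; exists (ereal_sup [set (average u n)%:E | n in
    [set n | (0 < n)%N /\ \sum_(i < n) u i <= c * n%:R]]); last first.
  apply/ge_ereal_sup => _ [n [n0 Hn] <-].
  by rewrite lee_fin /average mulrC ler_pdivrMr ?ltr0n.
exists [set n | (0 < n)%N /\ \sum_(i < n) u i <= c * n%:R] => //.
near=> n; split; near: n; [exact: nbhs_infty_gt|exact: Hc].
Unshelve. all: end_near. Qed.

Lemma near_const_le c C : 0 < c -> \forall n \near \oo, C <= c * n%:R.
Proof.
move=> c0; near=> n; rewrite mulrC -ler_pdivrMr //.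
near: n; exact: nbhs_infty_ger.
Unshelve. all: end_near. Qed.

(** A bounded additive error disappears in the average. *)
Lemma limsup_average_lt_affine u v a K C : 0 < K ->
  (forall n, \sum_(i < n) v i <= K * \sum_(i < n) u i + C) ->
  (limsup_average u < a%:E)%E -> (limsup_average v < (K * a)%:E)%E.
Proof.
move=> K0 uv /limsup_average_lt[c ca Hc]; apply/limsup_average_lt.
exists (K * ((c + a) / 2)); first by rewrite ltr_pM2l //; lra.
have e0 : 0 < K * ((a - c) / 2) by apply: mulr_gt0 => //; lra.
near=> n; have Hn : \sum_(i < n) u i <= c * n%:R by near: n.
have Cn : C <= K * ((a - c) / 2) * n%:R by near: n; exact: near_const_le.
have := uv n; have : K * \sum_(i < n) u i <= K * (c * n%:R) by rewrite ler_pM2l.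
nra.
Unshelve. all: end_near. Qed.

Lemma limsup_average_lt_mono u v a : (forall i, v i <= u i) ->
  (limsup_average u < a%:E)%E -> (limsup_average v < a%:E)%E.
Proof.
move=> vu /limsup_average_lt[c ca Hc]; apply/limsup_average_lt.
exists c => //; apply: filterS Hc => n; apply: le_trans.
by apply: ler_sum => i _; exact: vu.
Qed.

Lemma limsup_average_ltD u v w a b : (forall i, w i <= u i + v i) ->
  (limsup_average u < a%:E)%E -> (limsup_average v < b%:E)%E ->
  (limsup_average w < (a + b)%:E)%E.
Proof.
move=> wuv /limsup_average_lt[c ca Hc] /limsup_average_lt[d db Hd].
apply/limsup_average_lt; exists (c + d); first exact: ltrD.
near=> n; have : \sum_(i < n) w i <= \sum_(i < n) (u i + v i) by apply: ler_sum.
rewrite big_split /= => /le_trans; apply; rewrite mulrDl.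
by apply: lerD; near: n.
Unshelve. all: end_near. Qed.

Lemma limsup_average_lt_shift u a b :
  (limsup_average (fun i => (u i + b)%R) < (a + b)%:E)%E <->
  (limsup_average u < a%:E)%E.
Proof.
have sumE n : \sum_(i < n) (u i + b) = \sum_(i < n) u i + b * n%:R.
  by rewrite big_split /= sumr_const card_ord mulr_natr.
split=> /limsup_average_lt[c ca Hc]; apply/limsup_average_lt.
- exists (c - b); first by rewrite ltrBlDr.
  by apply: filterS Hc => n; rewrite sumE mulrBl lerBrDr.
- exists (c + b); first by rewrite ltrD2r.
  by apply: filterS Hc => n; rewrite sumE mulrDl lerD2r.
Qed.

Lemma average_cvg0P u : (forall i, 0 <= u i) ->
  average u @ \oo --> (0 : R) <->
  forall e, 0 < e -> (limsup_average u < e%:E)%E.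
Proof.
move=> u0; have s0 n : 0 <= \sum_(i < n) u i by apply: sumr_ge0.
have a0 n : 0 <= average u n by rewrite /average mulr_ge0 // invr_ge0.
split=> [/cvgr0Pnorm_le ua e e0|ua].
  apply/limsup_average_lt; exists (e / 2); first by lra.
  have e20 : 0 < e / 2 by lra.
  near=> n; have n0 : 0 < n%:R :> R by rewrite ltr0n; near: n; exact: nbhs_infty_gt.
  rewrite -ler_pdivrMr // mulrC -[X in X <= _]ger0_norm ?a0 //.
  by near: n; exact: ua.
apply/cvgr0Pnorm_le => e e0; have [c ce Hc] := (limsup_average_lt u e).1 (ua e e0).
near=> n; have n0 : 0 < n%:R :> R by rewrite ltr0n; near: n; exact: nbhs_infty_gt.
rewrite ger0_norm ?a0 // /average mulrC ler_pdivrMr //.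
have : \sum_(i < n) u i <= c * n%:R by near: n.
nra.
Unshelve. all: end_near. Qed.

Lemma frequency_average (A : set nat) :
  frequency R A = average (fun i => (i \in A)%:R).
Proof.
apply/funext => n; rewrite /frequency /average; congr (_ * _).
by rewrite -sum1_card natr_sum big_mkcond /=; apply: eq_bigr => i _; rewrite inE; case: ifP.
Qed.

Lemma frequency_ge u eps :
  frequency R [set i | eps <= u i] = average (fun i => (eps <= u i)%R%:R).
Proof.
rewrite frequency_average; congr average.
by apply/funext => i; rewrite mem_setE.
Qed.

(** Taking complements turns lower densities into upper averages, so that
    density and average conditions can be handled together. *)
Lemma lower_density_gt u a eps :
  (a%:E < lower_density R [set i | (u i < eps)%R])%E <->
  (limsup_average (fun i => ((eps <= u i)%R%:R : R)%R) < (1 - a)%:E)%E.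
Proof.
have -> : lower_density R [set i | u i < eps] =
    (- limsup_average (fun i => (- (u i < eps)%R%:R : R)%R))%E.
  rewrite /lower_density /limsup_average /limn_einf frequency_average.
  congr (- limn_esup _)%E; apply/funext => n; rewrite -EFinN /average; congr (_%:E).
  rewrite sumrN mulrN; congr (- (_ * _)).
  by apply: eq_bigr => i _; rewrite mem_setE.
rewrite lteNr -EFinN [1 - a]addrC -(limsup_average_lt_shift _ (- a) 1).
suff -> : (fun i => - (u i < eps)%R%:R + 1) = (fun i => (eps <= u i)%R%:R : R) by [].
by apply/funext => i; rewrite ltNge; case: (eps <= u i); rewrite /= ?oppr0 ?add0r ?addNr.
Qed.

(** Markov's inequality: eps times the indicator of [eps <= u] is below u. *)
Lemma limsup_average_markov u eps a : 0 < eps -> (forall i, 0 <= u i) ->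
  (limsup_average u < (eps * a)%:E)%E ->
  (limsup_average (fun i => ((eps <= u i)%R%:R : R)%R) < a%:E)%E.
Proof.
move=> eps0 u0 ua; rewrite -(mulKf (lt0r_neq0 eps0) a).
apply: (limsup_average_lt_affine (C := 0) _ _ ua); first by rewrite invr_gt0.
move=> n; rewrite addr0 mulr_sumr; apply: ler_sum => i _.
rewrite -ler_pdivrMl ?invr_gt0 // invrK.
by case: (leP eps (u i)) => h; rewrite ?mulr1 ?mulr0.
Qed.

(** Converse to Markov's inequality for bounded sequences: u is at most eps, or
    at most D where its indicator is 1. *)
Lemma limsup_average_split u eps D a : 0 < D -> 0 <= eps ->
  (forall i, u i <= D) ->
  (limsup_average (fun i => ((eps <= u i)%R%:R : R)%R) < a%:E)%E ->
  (limsup_average u < (D * a + eps)%:E)%E.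
Proof.
move=> D0 eps0 uD ua.
apply: (@limsup_average_lt_mono (fun i => D * (eps <= u i)%R%:R + eps)).
  move=> i; have := uD i.
  by case: (leP eps (u i)) => h; rewrite ?mulr1 ?mulr0 => ?; lra.
apply/limsup_average_lt_shift.
apply: (limsup_average_lt_affine (C := 0) D0 _ ua) => n.
by rewrite addr0 mulr_sumr.
Qed.

Lemma sum_addn u m n :
  \sum_(i < m + n) u i = \sum_(i < m) u i + \sum_(i < n) u (m + i)%N.
Proof. by rewrite big_split_ord. Qed.

Lemma sum_window_le u m k n : (forall i, 0 <= u i) -> (k + n <= m)%N ->
  \sum_(i < n) u (i + k)%N <= \sum_(i < m) u i.
Proof.
move=> u0 /subnKC <-; rewrite !sum_addn.
under eq_bigr do rewrite addnC.
have h1 : 0 <= \sum_(i < k) u i by apply: sumr_ge0.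
have h2 : 0 <= \sum_(i < m - (k + n)) u (k + n + i)%N by apply: sumr_ge0.
lra.
Qed.

Lemma sum_blocks_le u v N q :
  (forall b : nat, \sum_(j < N) u (b * N + j)%N <= \sum_(j < N) v (b * N + j)%N) ->
  \sum_(i < q * N) u i <= \sum_(i < q * N) v i.
Proof.
move=> uv; elim: q => [|q IH]; first by rewrite mul0n !big_ord0.
by rewrite mulSn addnC !sum_addn lerD.
Qed.

End AverageSums.

(** * Average shadowing against shadowing up to a small density *)

Section Shadowing.
Context {R : realType} {X : metricType R} (f : X -> X).
Implicit Types (x y : nat -> X) (z : X).

Lemma compact_mdist_bounded : compact [set: X] ->
  exists2 D : R, 0 < D & forall a b : X, mdist a b <= D.
Proof.
move=> /compact_near_coveringP cX.
have [[a0]|noX] := pselect (exists a : X, True); last first.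
  by exists 1 => // a; exfalso; apply: noX; exists a.
have [|N _ HN] := cX nat \oo (fun n a => mdist a0 a <= n%:R) _.
  move=> a _; exists ([set b | mdist a b < 1], [set n | mdist a0 a + 1 <= n%:R]) => /=.
    split; last exact: nbhs_infty_ger.
    by apply/metricType_numDomainType.nbhs_mdistP; exists 1 => //=.
  move=> [b n] /= [ab an]; rewrite (le_trans (metric_triangle a0 a b)) //.
  by apply: le_trans an; rewrite lerD2l ltW.
move=> _; exists (N%:R + N%:R + 1); first by rewrite ltr_wpDl.
move=> a b; have := metric_triangle a a0 b; rewrite (metric_sym a a0).
have /(_ a I) := HN N (leqnn N); have /(_ b I) := HN N (leqnn N).
by lra.
Qed.

Lemma M_shadowedP alpha eps x z : M_shadowed f alpha eps x z <->
  (limsup_average (fun i => ((eps <= tracing_error f x z i)%R%:R : R)%R)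
     < (1 - alpha)%:E)%E.
Proof. exact: lower_density_gt. Qed.

Lemma M_shadowed_of_average alpha eps x z : 0 < eps ->
  shadowed_on_average f (eps * (1 - alpha)) x z -> M_shadowed f alpha eps x z.
Proof.
move=> eps0 sh; apply/M_shadowedP; apply: limsup_average_markov => // i.
exact: mdist_ge0.
Qed.

Lemma average_of_M_shadowed eps : compact [set: X] -> 0 < eps ->
  exists2 alpha : R, 0 <= alpha < 1 & forall x z,
    M_shadowed f alpha (eps / 2) x z -> shadowed_on_average f eps x z.
Proof.
move=> /compact_mdist_bounded[D D0 XD] eps0.
have De0 : 0 < 2 * D + eps by lra.
(* chosen so that D * (1 - alpha) < eps / 2 *)
exists (2 * D / (2 * D + eps)).
  by rewrite divr_ge0 ?ltr_pdivrMr //=; lra.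
move=> x z /M_shadowedP sh.
have := limsup_average_split (eps := eps / 2) D0 _ (fun i => XD _ _) sh.
move=> /(_ ltac:(lra)) /lt_le_trans; apply.
rewrite lee_fin.
have -> : 1 - 2 * D / (2 * D + eps) = eps / (2 * D + eps) by field; lra.
have : D * (eps / (2 * D + eps)) <= eps / 2.
  by rewrite mulrA ler_pdivrMr //; nra.
lra.
Qed.

(** * Repairing bad blocks *)

Definition asymptotic_error_shadowing_property : Prop :=
  forall eps : R, 0 < eps -> exists delta : R, 0 < delta /\
    forall x, delta_asymptotic_average_pseudo_orbit f delta x ->
      exists z, shadowed_on_average f eps x z.

(** A block on which x has total error above eta N is replaced by the true
    orbit of its first point. First points of blocks are never changed, so a
    replaced block has a single possibly nonzero error, at its last index, and
    that one is at most D <= eta N. The distance between x and y on such a block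
    is at most D N, that is D / eta times the bound eta N which the error of x
    exceeds. *)
Lemma block_repair (D eta : R) (N : nat) x :
  (forall a b : X, mdist a b <= D) -> 0 < D -> 0 < eta -> D <= eta * N%:R ->
  exists y,
    (forall b, \sum_(j < N) step_error f y (b * N + j)%N <= eta * N%:R) /\
    (forall b, \sum_(j < N) mdist (y (b * N + j)%N) (x (b * N + j)%N) <=
       \sum_(j < N) (D / eta * step_error f x (b * N + j)%N)).
Proof.
move=> XD D0 eta0 DN.
have N0 : (0 < N)%N by rewrite lt0n; apply/eqP => N0; move: DN; rewrite N0; lra.
pose good b := \sum_(j < N) step_error f x (b * N + j)%N <= eta * N%:R.
pose y i := if good (i %/ N)%N then x i else iter (i %% N) f (x (i %/ N * N)%N).
have yE b j : (j < N)%N ->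
    y (b * N + j)%N = if good b then x (b * N + j)%N else iter j f (x (b * N)%N).
  by move=> jN; rewrite /y divnMDl // divn_small // addn0 modnMDl modn_small.
have y0 b : y (b * N)%N = x (b * N)%N.
  by rewrite -[X in y X]addn0 yE // addn0; case: ifP.
exists y; split=> b.
- have [gb|/negbTE bb] := boolP (good b).
    rewrite [X in X <= _](_ : _ = \sum_(j < N) step_error f x (b * N + j)%N) //.
    apply: eq_bigr => j _; rewrite /step_error yE // gb.
    (* the last error of a block involves the first point of the next one *)
    case: (ltnP j.+1 N) => jN; first by rewrite -addnS yE // gb addnS.
    have -> : (b * N + j).+1 = (b.+1 * N)%N by have := ltn_ord j; nia.
    by rewrite y0.
  apply: le_trans DN; case: N N0 @good @y bb yE y0 => // N _ good y bb yE y0.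
  rewrite big_ord_recr /= big1 ?add0r; first exact: XD.
  move=> j _; rewrite /step_error -addnS !yE ?bb /= ?mdistxx //.
    by rewrite ltnS.
  exact: (ltnW (ltn_ord j)).
- have [gb|bb] := boolP (good b).
    rewrite big1 => [|j _]; last by rewrite yE // gb mdistxx.
    by apply: sumr_ge0 => j _; rewrite mulr_ge0 ?mdist_ge0 // ltW // divr_gt0.
  rewrite -mulr_sumr; apply: (@le_trans _ _ (\sum_(j < N) D)).
    by apply: ler_sum => j _; exact: XD.
  rewrite sumr_const card_ord -mulr_natr -mulrA ler_pM2l // ler_pdivlMl //.
  by move: bb; rewrite /good -ltNge => /ltW.
Qed.

(** A window of length n >= N meets at most n / N + 2 blocks, which together
    have length at most 3 n. *)
Lemma sum_le_of_blocks (u : nat -> R) (eta : R) (N k n : nat) :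
  (forall i, 0 <= u i) -> 0 <= eta -> (0 < N <= n)%N ->
  (forall b : nat, \sum_(j < N) u (b * N + j)%N <= eta * N%:R) ->
  \sum_(i < n) u (i + k)%N <= 3 * eta * n%:R.
Proof.
move=> u0 eta0 /andP[N0 Nn] ub.
pose k0 := (k %/ N)%N; pose r := (k %% N)%N; pose q := (n %/ N).+2.
have kE : k = (k0 * N + r)%N by exact: divn_eq.
have rN : (r < N)%N by rewrite ltn_mod.
have nE : n = (n %/ N * N + n %% N)%N by exact: divn_eq.
have nN : (n %% N < N)%N by rewrite ltn_mod.
pose v i := u (k0 * N + i)%N.
have -> : \sum_(i < n) u (i + k)%N = \sum_(i < n) v (i + r)%N.
  by apply: eq_bigr => i _; rewrite /v kE; congr u; lia.
have rnq : (r + n <= q * N)%N by rewrite /q; nia.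
apply: (le_trans (sum_window_le (fun i => u0 _) rnq)).
apply: (@le_trans _ _ (\sum_(i < q * N) eta)).
  apply: (@sum_blocks_le _ v (fun=> eta)) => b.
  rewrite sumr_const card_ord -mulr_natr.
  have := ub (k0 + b)%N; congr (_ <= _); apply: eq_bigr => j _.
  by rewrite /v; congr u; lia.
rewrite sumr_const card_ord -[X in X <= _]mulr_natr [3 * eta]mulrC -mulrA ler_wpM2l //.
rewrite -natrM ler_nat /q; nia.
Qed.

(** A point shadowing the block repair y of x shadows x, as the mean distance
    between x and y is at most D / eta times the mean error of x. *)
Lemma average_shadowing_asymptotic_error : compact [set: X] ->
  average_shadowing_property f ->
  asymptotic_error_shadowing_property.
Proof.
move=> /compact_mdist_bounded[D D0 XD] asp eps eps0.
have [delta [delta0 sh]] := asp (eps / 2) ltac:(lra).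
(* any eta with 3 * eta < delta will do, by [sum_le_of_blocks] *)
pose eta := delta / 4; have eta0 : 0 < eta by rewrite /eta; lra.
have K0 : 0 < D / eta by rewrite divr_gt0.
exists (eps / 2 / (D / eta)); split; first by rewrite divr_gt0 //; lra.
move=> x xpo.
have [N N0 DN] : exists2 N : nat, (0 < N)%N & D <= eta * N%:R.
  have [N _ HN] := near_const_le D eta0.
  by exists N.+1 => //; apply: HN; rewrite /= leqnSn.
have [y [yE yx]] := block_repair x XD D0 eta0 DN.
have [|z yz] := sh y.
  exists N; split=> // n k Nn.
  have n0 : 0 < n%:R :> R by rewrite ltr0n; apply: leq_trans Nn.
  rewrite /average mulrC ltr_pdivrMr //.
  have := @sum_le_of_blocks (step_error f y) eta N k n (fun i => mdist_ge0 _ _).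
  rewrite ltW // N0 Nn => /(_ isT isT yE); rewrite /eta; nra.
exists z; rewrite /shadowed_on_average.
have -> : eps = eps / 2 + eps / 2 by lra.
apply: (limsup_average_ltD _ yz (v := fun i => mdist (y i) (x i))).
  by move=> i; exact: metric_triangle.
have -> : eps / 2 = D / eta * (eps / 2 / (D / eta)) by field; rewrite !lt0r_neq0.
apply: (limsup_average_lt_affine (C := D * N%:R) K0 _ xpo) => n.
have nE (u : nat -> R) : \sum_(i < n) u i = \sum_(i < n %/ N * N) u i +
    \sum_(i < n %% N) u (n %/ N * N + i)%N by rewrite -sum_addn -divn_eq.
rewrite (nE (fun i => mdist (y i) (x i))); apply: lerD.
  have := @sum_blocks_le _ (fun i => mdist (y i) (x i))
    (fun i => D / eta * step_error f x i) N (n %/ N) yx.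
  move=> /le_trans; apply.
  rewrite -mulr_sumr ler_pM2l // (nE (step_error f x)) lerDl.
  by apply: sumr_ge0 => i _; exact: mdist_ge0.
apply: (@le_trans _ _ (\sum_(i < n %% N) D)); first by apply: ler_sum => i _; exact: XD.
rewrite sumr_const card_ord -[X in X <= _]mulr_natr ler_pM2l // ler_nat.
by rewrite ltnW // ltn_mod.
Qed.

(** * Concatenating pseudo-orbits that are not shadowed *)

Lemma continuous_mdistl (b : X) : continuous (fun a : X => mdist a b : R).
Proof.
move=> a; apply/cvgrPdist_lt => e e0.
apply/metricType_numDomainType.nbhs_mdistP; exists e => //= a' /= aa'.
have := metric_triangle a a' b; have := metric_triangle a' a b.
rewrite (metric_sym a' a) ltr_norml => ? ?; apply/andP; split; lra.
Qed.

Lemma continuous_sum_tracing_error x n : continuous f ->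
  continuous (fun z => \sum_(i < n) tracing_error f x z i).
Proof.
move=> cf; have ci i : continuous (fun z => iter i f z).
  elim: i => [|i IH] z; first exact: cvg_id.
  exact: (continuous_comp (IH z) (cf _)).
elim: n => [|n IH].
  under eq_fun do rewrite big_ord0.
  by move=> z; exact: cvg_cst.
under eq_fun do rewrite big_ord_recr.
move=> z; apply: cvgD; first exact: IH.
exact: (continuous_comp (ci n z) (@continuous_mdistl (x n) _)).
Qed.

(** For a single z a bad time L beyond L0 exists since z does not shadow x; the
    same L works near z by continuity, and compactness bounds it uniformly. *)
Lemma uniform_unshadowed_window x (c eps : R) (L0 : nat) :
  compact [set: X] -> continuous f -> c < eps ->
  (forall z, ~ shadowed_on_average f eps x z) ->
  exists L1 : nat, forall z, exists L : nat, (L0 <= L <= L1)%N /\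
    c * L%:R < \sum_(i < L) tracing_error f x z i.
Proof.
move=> /compact_near_coveringP cX cf ce noz.
have [|L1 _ HL1] := cX nat \oo (fun L1 z => exists L : nat, (L0 <= L <= L1)%N /\
    c * L%:R < \sum_(i < L) tracing_error f x z i) _; last first.
  by exists L1 => z; exact: (HL1 L1 (leqnn L1) z I).
move=> z _.
have [L L0L zL] : exists2 L : nat, (L0 <= L)%N &
    c * L%:R < \sum_(i < L) tracing_error f x z i.
  apply: contrapT => noL; apply: (noz z); apply/limsup_average_lt.
  exists c => //; exists L0 => // L L0L /=; rewrite leNgt; apply/negP => zL.
  by apply: noL; exists L.
exists ([set z' | c * L%:R < \sum_(i < L) tracing_error f x z' i],
        [set L1 | (L <= L1)%N]) => /=.
  split; last exact: nbhs_infty_ge.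
  exact: (cvgr_gt _ (@continuous_sum_tracing_error x L cf z)).
by move=> [z' L1] /= [z'L LL1]; exists L; rewrite L0L LL1.
Qed.

(** Some t n may coincide, so a block can be empty; at each time at most one
    block prescribes a value. *)
Lemma glue (t : nat -> nat) (s : nat -> nat -> X) :
  (forall n, (t n <= t n.+1)%N) ->
  exists y, forall n j, (t n + j < t n.+1)%N -> y (t n + j)%N = s n j.
Proof.
move=> tS; have tm : {homo t : m n / (m <= n)%N}.
  by apply: homo_leq => // n; apply: leq_trans.
suff /choice[y yP] : forall i : nat, exists v : X, forall n j, i = (t n + j)%N ->
    (t n + j < t n.+1)%N -> v = s n j.
  by exists y => n j; exact: yP.
move=> i.
have [[n [j [ij tj]]]|no] := pselect (exists n j, i = (t n + j)%N /\ (t n + j < t n.+1)%N).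
  exists (s n j) => n' j' ij' tj'.
  have nn' : n = n'.
    case: (ltngtP n n') => // /tm; lia.
  by subst n'; congr (s _ _); lia.
by exists (s 0 0)%N => n j ij tj; exfalso; apply: no; exists n, j.
Qed.

(** C n absorbs the initial stretch during which the mean error of s n is not
    yet below 1 / (n + 1), and G prescribes how long each segment must be, as a
    function of its index and starting time. Each segment is moreover long
    enough to dominate D t_n, a bound for all earlier errors, the constant of
    its own segment and that of the next one: the mean error is then at most
    2 / (n + 1) throughout segment n + 1. *)
Lemma concatenate (D : R) (s : nat -> nat -> X) (C : nat -> R) (G : nat -> nat -> nat) :
  (forall a b : X, mdist a b <= D) ->
  (forall n m, \sum_(i < m) step_error f (s n) i <= n.+1%:R^-1 * m%:R + C n) ->
  exists t y, [/\ forall n, (n <= t n)%N,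
    forall n, (t n + G n (t n) <= t n.+1)%N,
    forall n j, (t n + j < t n.+1)%N -> y (t n + j)%N = s n j &
    asymptotic_average_pseudo_orbit f y].
Proof.
move=> XD sC; pose d n : R := n.+1%:R^-1.
have d0 n : 0 < d n by rewrite invr_gt0.
have dle m n : (m <= n)%N -> d n <= d m.
  by move=> mn; rewrite lef_pV2 ?posrE // ler_nat.
have D0 : 0 <= D by apply: le_trans (XD (s 0 0)%N (s 0 0)%N); exact: mdist_ge0.
have /choice[F FP] : forall p : nat * nat, exists k : nat, (0 < k)%N /\
    (G p.1 p.2 <= k)%N /\
    D * p.2%:R + (C p.1 + D) + (C p.1.+1 + D) <= d p.1 * (p.2 + k)%:R.
  move=> [n m] /=.
  have [K _ HK] := near_const_le (D * m%:R + (C n + D) + (C n.+1 + D)) (d0 n).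
  exists (maxn (G n m) K).+1; split=> //; split; first by lia.
  by apply: HK => /=; lia.
pose t := fix t n := if n is n'.+1 then (t n' + F (n', t n'))%N else 0%N.
have tS n : t n.+1 = (t n + F (n, t n))%N by [].
have tn n : (n <= t n)%N.
  by elim: n => // n IH; rewrite tS; have [] := FP (n, t n); lia.
have [y yE] := @glue t s (fun n => leq_addr _ _).
exists t, y; split=> //; first by move=> n; rewrite tS leq_add2l; have [_ []] := FP (n, t n).
have eD i : step_error f y i <= D by exact: XD.
have e0 i : 0 <= step_error f y i by exact: mdist_ge0.
(* the additional D pays for the junction at the end of the segment *)
have seg n j : (t n + j <= t n.+1)%N ->
    \sum_(i < j) step_error f y (t n + i)%N <= d n * j%:R + (C n + D).
  have dj k : d n * k%:R <= d n * k.+1%:R.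
    by rewrite ler_pM2l // ler_nat.
  case: j => [_|j tj].
    by have := sC n 0%N; rewrite !big_ord0 mulr0; lra.
  rewrite big_ord_recr /= addrA; apply: lerD => //.
  apply: le_trans (le_trans (sC n j) _); last by rewrite lerD2r.
  apply: ler_sum => i _; rewrite /step_error -addnS !yE //.
    by have := ltn_ord i; lia.
  by have := ltn_ord i; lia.
have tot n j : (t n.+1 + j <= t n.+2)%N ->
    \sum_(i < t n.+1 + j) step_error f y i <= 2 * d n * (t n.+1 + j)%:R.
  move=> tj; rewrite sum_addn.
  have tsum : \sum_(i < t n.+1) step_error f y i = \sum_(i < t n) step_error f y i +
    \sum_(i < F (n, t n)) step_error f y (t n + i)%N by exact: sum_addn.
  rewrite tsum.
  have h1 : \sum_(i < t n) step_error f y i <= D * (t n)%:R.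
    apply: (@le_trans _ _ (\sum_(i < t n) D)); first by apply: ler_sum.
    by rewrite sumr_const card_ord mulr_natr.
  have h2 := seg n (F (n, t n)) (leqnn _).
  have h3 := seg n.+1 j tj.
  have [_ [_ /= h4]] := FP (n, t n).
  have h5 : d n.+1 * j%:R <= d n * j%:R by rewrite ler_wpM2r // dle.
  have h6 : 0 <= d n * (t n)%:R by rewrite mulr_ge0 // ltW.
  have h7 : 0 <= d n * j%:R by rewrite mulr_ge0 // ltW.
  by move: h3 h4; rewrite ?tS !natrD; lra.
apply/average_cvg0P => // e he; apply/limsup_average_lt.
have [n ne] : exists n, 2 * d n < e.
  have [n _ Hn] := near_const_le 2 he.
  exists n; rewrite /d -[_ < _]/(2 / _ < _) ltr_pdivrMr //.
  by have := Hn n (leqnn n); rewrite -[n.+1]addn1 natrD; lra.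
exists (2 * d n) => //; exists (t n.+1) => // m /= nm.
(* m lies in segment k + 1, where k is the largest index with t k.+1 <= m *)
have bd k : (t k.+1 <= m)%N -> (k <= m)%N by have := tn k.+1; lia.
have exP : exists k, (t k.+1 <= m)%N by exists n.
case: (ex_maxnP exP bd) => k km kmax.
have nk := kmax n nm.
have mk : (m < t k.+2)%N by rewrite ltnNge; apply/negP => /kmax; rewrite ltnn.
have := tot k (m - t k.+1)%N; rewrite subnKC // => /(_ (ltnW mk)) /le_trans; apply.
by rewrite ler_wpM2r // ler_pM2l // dle.
Qed.

(** Were the conclusion false, ever better pseudo-orbits that no point shadows
    could be concatenated into an asymptotic average pseudo-orbit on which every
    orbit fails, in each segment, for at least as long as the segment's past. *)
Lemma weak_asymptotic_shadowing_asymptotic_error : compact [set: X] -> continuous f ->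
  weak_asymptotic_average_shadowing_property f ->
  asymptotic_error_shadowing_property.
Proof.
move=> cX cf wasp eps eps0; apply: contrapT => no.
have [D D0 XD] := compact_mdist_bounded cX.
have /choice[s sP] : forall n : nat, exists x,
    delta_asymptotic_average_pseudo_orbit f n.+1%:R^-1 x /\
    forall z, ~ shadowed_on_average f eps x z.
  move=> n; apply: contrapT => nox; apply: no; exists n.+1%:R^-1.
  split; first by rewrite invr_gt0.
  move=> x xpo; apply: contrapT => noz; apply: nox; exists x; split=> // z xz.
  by apply: noz; exists z.
have /choice[C sC] : forall n : nat, exists C : R, forall m : nat,
    \sum_(i < m) step_error f (s n) i <= n.+1%:R^-1 * m%:R + C.
  move=> n; have [/limsup_average_lt[c cn [N _ HN]] _] := sP n.
  exists (D * N%:R) => m; case: (leqP N m) => Nm.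
    apply: (le_trans (HN m Nm)); rewrite -[X in X <= _]addr0 lerD //.
      by rewrite ler_wpM2r // ltW.
    by rewrite mulr_ge0 // ltW.
  apply: (@le_trans _ _ (\sum_(i < m) D)); first by apply: ler_sum => i _; exact: XD.
  rewrite sumr_const card_ord -[X in X <= _]mulr_natr.
  rewrite -[X in X <= _]add0r lerD //.
  by rewrite ler_pM2l // ler_nat ltnW.
have /choice[G GP] : forall p : nat * nat, exists L1 : nat, forall z, exists L : nat,
    (p.2 <= L <= L1)%N /\ eps / 2 * L%:R < \sum_(i < L) tracing_error f (s p.1) z i.
  by move=> p; apply: (uniform_unshadowed_window p.2 cX cf _ (sP p.1).2); lra.
have [t [y [tn tG yE ypo]]] := concatenate (fun n k => G (n, k)) XD sC.
have [z /limsup_average_lt[c ce [N _ HN]]] := wasp (eps / 4) ltac:(lra) y ypo.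
(* in segment N the orbit of z restarts from its point at time t N; as
   t N <= L, an error above eps / 2 * L is above eps / 4 * (t N + L) *)
have [L [/= /andP[NL LG] Lz]] := GP (N, t N) (iter (t N) f z).
have := HN (t N + L)%N; rewrite /= sum_addn => /(_ (leq_trans (tn N) (leq_addr _ _))).
have -> : \sum_(i < L) tracing_error f y z (t N + i)%N =
    \sum_(i < L) tracing_error f (s N) (iter (t N) f z) i.
  apply: eq_bigr => i _; rewrite /tracing_error addnC iterD addnC yE //.
  by have := tG N; have := ltn_ord i; lia.
have : 0 <= \sum_(i < t N) tracing_error f y z i.
  by apply: sumr_ge0 => i _; exact: mdist_ge0.
have : (t N)%:R <= L%:R :> R by rewrite ler_nat.
have : 0 <= (t N)%:R :> R by [].
rewrite natrD; nra.
Qed.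

(** * Elementary implications *)

Lemma asymptotic_error_shadowing_average :
  asymptotic_error_shadowing_property -> average_shadowing_property f.
Proof.
move=> sp eps eps0; have [delta [delta0 sh]] := sp eps eps0.
exists (delta / 2); split; first by lra.
move=> x [N [N0 xN]]; apply: sh; apply/limsup_average_lt.
exists (delta / 2); first by lra.
exists N => // n /= Nn; have n0 : 0 < n%:R :> R by rewrite ltr0n; apply: leq_trans Nn.
have := xN n 0%N Nn; rewrite /average mulrC ltr_pdivrMr // => /ltW.
congr (_ <= _); apply: eq_bigr => i _; congr (step_error f x _); exact: addn0.
Qed.

(** A delta / 2-ergodic pseudo-orbit has errors below delta / 2 off a set of
    density zero, on which they are bounded by the diameter, so the limsup of
    its mean error is below delta. *)
Lemma asymptotic_error_shadowing_M (alpha : R) : compact [set: X] ->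
  0 <= alpha < 1 ->
  asymptotic_error_shadowing_property -> M_shadowing_property f alpha.
Proof.
move=> /compact_mdist_bounded[D D0 XD] /andP[_ alpha1] sp eps eps0.
have [|delta [delta0 sh]] := sp (eps * (1 - alpha)).
  by rewrite mulr_gt0 // subr_gt0.
exists (delta / 2); split; first by lra.
move=> x; rewrite /ergodic_pseudo_orbit frequency_ge => xerg.
have [|z xz] := sh x; last by exists z; exact: M_shadowed_of_average.
rewrite /delta_asymptotic_average_pseudo_orbit.
have -> : delta = D * (delta / 2 / D) + delta / 2 by field; rewrite lt0r_neq0.
apply: limsup_average_split => //; first by lra.
  by move=> i; exact: XD.
have e0 : 0 < delta / 2 / D by rewrite !divr_gt0.
by move/average_cvg0P: xerg; apply.
Qed.

(** By Markov's inequality an asymptotic average pseudo-orbit is delta-ergodic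
    for every delta. *)
Lemma M_shadowing_asymptotic_average (alpha eps : R) x :
  M_shadowing_property f alpha -> 0 < eps ->
  asymptotic_average_pseudo_orbit f x -> exists z, M_shadowed f alpha eps x z.
Proof.
move=> Msp eps0 /average_cvg0P xpo; have [delta [delta0 sh]] := Msp eps eps0.
apply: sh; rewrite /ergodic_pseudo_orbit frequency_ge.
apply/average_cvg0P => // e e0.
apply: limsup_average_markov => // [i|]; first exact: mdist_ge0.
apply: xpo => [i|]; [exact: mdist_ge0|exact: mulr_gt0].
Qed.

End Shadowing.

Theorem theorem5p5 (R : realType) (X : metricType R) (f : X -> X)
    (compactX : compact [set: X]) (continuous_f : continuous f) :
  [<-> average_shadowing_property f;
       forall alpha : R, 0 <= alpha < 1 -> M_shadowing_property f alpha;
       weak_asymptotic_average_shadowing_property f;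
       forall alpha eps : R, 0 <= alpha < 1 -> 0 < eps ->
         forall x : nat -> X, asymptotic_average_pseudo_orbit f x ->
           exists z : X, M_shadowed f alpha eps x z;
       forall alpha eps : R, 0 <= alpha < 1 -> 0 < eps ->
         exists delta : R, 0 < delta /\
           forall x : nat -> X, average_pseudo_orbit f delta x ->
             exists z : X, M_shadowed f alpha eps x z;
       forall eps : R, 0 < eps ->
         exists delta : R, 0 < delta /\
           forall x : nat -> X, delta_asymptotic_average_pseudo_orbit f delta x ->
             exists z : X, shadowed_on_average f eps x z].
Proof.
have B := average_shadowing_asymptotic_error compactX.
have A := weak_asymptotic_shadowing_asymptotic_error compactX continuous_f.
tfae.
- move=> /B s6 alpha alpha01; exact: asymptotic_error_shadowing_M.
- move=> s2 eps eps0 x xpo.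
  have [alpha alpha01 aM] := average_of_M_shadowed f compactX eps0.
  have [|z /aM xz] := M_shadowing_asymptotic_average (s2 alpha alpha01) _ xpo (eps := eps / 2).
    by rewrite divr_gt0.
  by exists z.
- move=> s3 alpha eps /andP[_ alpha1] eps0 x xpo.
  have [|z xz] := s3 (eps * (1 - alpha)) _ x xpo; last first.
    by exists z; exact: M_shadowed_of_average.
  by rewrite mulr_gt0 // subr_gt0.
- move=> s4 alpha eps /andP[_ alpha1] eps0.
  have /A/asymptotic_error_shadowing_average s1 : weak_asymptotic_average_shadowing_property f.
    move=> e e0 x xpo; have [a a01 aM] := average_of_M_shadowed f compactX e0.
    by have [|z /aM xz] := s4 a (e / 2) a01 _ x xpo; [rewrite divr_gt0|exists z].
  have [|delta [delta0 sh]] := s1 (eps * (1 - alpha)).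
    by rewrite mulr_gt0 // subr_gt0.
  exists delta; split=> // x /sh[z xz].
  by exists z; exact: M_shadowed_of_average.
- move=> s5; apply: B => eps eps0.
  have [a a01 aM] := average_of_M_shadowed f compactX eps0.
  have [|delta [delta0 sh]] := s5 a (eps / 2) a01; first by rewrite divr_gt0.
  by exists delta; split=> // x /sh[z /aM xz]; exists z.
- exact: asymptotic_error_shadowing_average.
Qed.
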